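(* Let $M\in\mathbb{R}^{p\times p}$ be symmetric positive definite with ordered eigenvalues $\lambda_1\ge\dots\ge\lambda_p$ and orthonormal eigenvectors $v_1,\dots,v_p$, let $1\le d<p$, and assume $\Delta=\min_{1\le j\le d}(\lambda_j-\lambda_{j+1})>0$. Let $\tau_0=\max_{1\le k\le d}\|v_k\|_1$. Let $\widehat M=X_n^{T}X_n$ for some $X_n\in\mathbb{R}^{n\times p}$ and let $\widehat v_1,\dots,\widehat v_d$ be the penalized matrix decomposition (PMD) vectors of $\widehat M$ with $\ell_1$-bound $\tau$. If $\tau>\tau_0$ and $\|\widehat M-M\|_{\max}\le\epsilon$, then there exists a constant $c_0>0$ that does not depend on $n$, $p$ or $\epsilon$ such that $$\sin^2\Theta(v_k,\widehat v_k)\le c_0\,\epsilon\,\tau^2,\qquad k=1,\dots,d.$$ (The constant $c_0$ may depend on $d$, $\Delta$ and $\lambda_1,\dots,\lambda_d$.)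
   Context: $\|A\|_{\max}=\max_{i,j}|a_{ij}|$; $\|v\|_1,\|v\|_2$ are vector $\ell_1$ and Euclidean norms. $\Theta(v,w)$ is the angle between the lines spanned by $v$ and $w$, i.e. $\sin^2\Theta(v,w)=1-(v^{T}w)^2/(\|v\|_2^2\|w\|_2^2)$ (taken to be $1$ if $v$ or $w$ is zero). PMD vectors of $\widehat M$ with bound $\tau$: set $\widehat M_1=\widehat M$; for $k=1,\dots,d$, $\widehat v_k$ is a maximizer of $v^{T}\widehat M_kv$ over $v\in\mathbb{R}^p$ subject to $\|v\|_1\le\tau$ and $\|v\|_2^2\le1$, and $\widehat M_{k+1}=(I_p-\widehat v_k\widehat v_k^{T})\widehat M_k(I_p-\widehat v_k\widehat v_k^{T})$. The vectors $\widehat v_k$ need be neither of unit norm nor mutually orthogonal. $d$ is fixed. *)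

(* Defs.v *)
From HB Require Import structures.
From mathcomp Require Import all_boot all_order all_algebra.
From mathcomp Require Import reals matrix_normedtype.

Set Implicit Arguments.
Unset Strict Implicit.
Unset Printing Implicit Defensive.

Import Order.TTheory GRing.Theory Num.Theory.
Local Open Scope ring_scope.

(* Vectors are columns.  The entrywise maximum norm of a matrix is the
   library's [mx_norm].  Indices are shifted down by one: the eigenpairs
   1, ..., p and the PMD vectors 1, ..., d are indexed by 'I_p and 'I_d. *)

Definition l1norm (R : realType) (p : nat) (v : 'cV[R]_p) : R :=
  \sum_i `|v i 0|.

Definition l2norm (R : realType) (p : nat) (v : 'cV[R]_p) : R :=
  Num.sqrt (\sum_i v i 0 ^+ 2).

Definition sin2_angle (R : realType) (p : nat) (v w : 'cV[R]_p) : R :=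
  if (v == 0) || (w == 0) then 1
  else 1 - ((v^T *m w) 0 0) ^+ 2 / (l2norm v ^+ 2 * l2norm w ^+ 2).

Definition quad_form (R : realType) (p : nat) (A : 'M[R]_p) (v : 'cV[R]_p) : R :=
  (v^T *m A *m v) 0 0.

Definition sym_posdef (R : realType) (p : nat) (A : 'M[R]_p) : Prop :=
  A^T = A /\ forall v : 'cV[R]_p, v != 0 -> 0 < quad_form A v.

Record ordered_eigensystem (R : realType) (p : nat) (A : 'M[R]_p)
    (lambda : 'I_p -> R) (v : 'I_p -> 'cV[R]_p) : Prop := OrderedEigensystem {
  eigen_eq : forall i, A *m v i = lambda i *: v i;
  eigen_orthonormal : forall i j, ((v i)^T *m v j) 0 0 = (i == j)%:R;
  eigen_ordered : forall i j : 'I_p, (i <= j)%N -> lambda j <= lambda i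
}.

(* For j < d < p: [lead dp j] and [lead_next dp j] are j and j + 1 in 'I_p. *)
Definition lead (d p : nat) (dp : (d < p)%N) (j : 'I_d) : 'I_p :=
  widen_ord (ltnW dp) j.

Definition lead_next (d p : nat) (dp : (d < p)%N) (j : 'I_d) : 'I_p :=
  Ordinal (leq_ltn_trans (ltn_ord j) dp).

Definition gap (R : realType) (d p : nat) (dp : (d < p)%N) (lambda : 'I_p -> R)
    (j : 'I_d) : R :=
  lambda (lead dp j) - lambda (lead_next dp j).

(* The iterated minimum needs a starting value; the gap at the first index,
   available since d > 0, is one of the terms and hence does not change it. *)
Definition min_gap (R : realType) (d p : nat) (d_gt0 : (0 < d)%N)
    (dp : (d < p)%N) (lambda : 'I_p -> R) : R :=
  \big[Num.min/gap dp lambda (Ordinal d_gt0)]_(j < d) gap dp lambda j.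

Definition max_l1norm (R : realType) (d p : nat) (dp : (d < p)%N)
    (v : 'I_p -> 'cV[R]_p) : R :=
  \big[Num.max/0]_(k < d) l1norm (v (lead dp k)).

Definition pmd_feasible (R : realType) (p : nat) (tau : R) (v : 'cV[R]_p) : Prop :=
  l1norm v <= tau /\ l2norm v ^+ 2 <= 1.

Definition pmd_maximizer (R : realType) (p : nat) (tau : R) (A : 'M[R]_p)
    (v : 'cV[R]_p) : Prop :=
  pmd_feasible tau v /\
  forall w : 'cV[R]_p, pmd_feasible tau w -> quad_form A w <= quad_form A v.

Definition deflate (R : realType) (p : nat) (A : 'M[R]_p) (v : 'cV[R]_p) : 'M[R]_p :=
  (1%:M - v *m v^T) *m A *m (1%:M - v *m v^T).

Fixpoint deflated (R : realType) (p : nat) (A : 'M[R]_p) (v : nat -> 'cV[R]_p)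
    (k : nat) : 'M[R]_p :=
  if k is j.+1 then deflate (deflated A v j) (v j) else A.

(* Only v 0, ..., v (d - 1) matter; the later values are unconstrained.
   Maximizers need not be unique: any choice is allowed. *)
Definition pmd_vectors (R : realType) (p : nat) (d : nat) (tau : R) (A : 'M[R]_p)
    (v : nat -> 'cV[R]_p) : Prop :=
  forall k : nat, (k < d)%N -> pmd_maximizer tau (deflated A v k) (v k).

(* Main.v *)
(* Write e for eps * tau ^ 2.  The quadratic forms of Mhat and M differ by at
   most e on vectors of l1-norm at most tau, so comparing vhat_1 with v_1
   settles the first index.  For later indices, vhat_j is only within sqrt e of
   v_j, which naively would cost a square root at each deflation.  Write
   P_j = I - vhat_j vhat_j^T and Q_k = P_1 ... P_(k-1), so that
   Mhat_k = Q_k^T Mhat Q_k.  Two second-order facts keep the error linear in e: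
   <Q_k^T v_k, v_k> >= 1 - O(e), because the first-order terms in
   <vhat_j, v_k> enter only through products of two such factors, and
   |Q_k^T v_j|^2 = O(e) for j < k.  The first gives a lower bound
   lambda_k - O(e) on the maximum of the k-th program; the second, with the gap,
   forces <vhat_k, Q_k^T v_k>^2 >= 1 - O(e); since Q_k^T v_k is within
   sqrt (O(e)) of v_k, so is vhat_k up to sign. *)
Require Import Defs.
From HB Require Import structures.
From mathcomp Require Import all_boot all_order all_algebra.
From mathcomp Require Import reals matrix_normedtype.
From mathcomp Require Import ring lra.

Set Implicit Arguments.
Unset Strict Implicit.
Unset Printing Implicit Defensive.

Import Order.TTheory GRing.Theory Num.Theory.
Local Open Scope ring_scope.

(** * Inner product, norms and quadratic forms *)

Definition dot (R : realType) (p : nat) (u v : 'cV[R]_p) : R := (u^T *m v) 0 0.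

Section Dot.
Variables (R : realType) (p : nat).
Implicit Types (u v w : 'cV[R]_p) (A : 'M[R]_p).

Lemma dotE u v : dot u v = \sum_i u i 0 * v i 0.
Proof. by rewrite /dot mxE; apply: eq_bigr => i _; rewrite mxE. Qed.

Lemma dotC u v : dot u v = dot v u.
Proof. by rewrite !dotE; apply: eq_bigr => i _; rewrite mulrC. Qed.

Lemma dotDl u v w : dot (u + v) w = dot u w + dot v w.
Proof. by rewrite /dot linearD mulmxDl mxE. Qed.

Lemma dotZl c u v : dot (c *: u) v = c * dot u v.
Proof. by rewrite /dot linearZ -scalemxAl mxE. Qed.

Lemma dotBl u v w : dot (u - v) w = dot u w - dot v w.
Proof. by rewrite dotDl -scaleN1r dotZl mulN1r. Qed.

Lemma dotDr u v w : dot u (v + w) = dot u v + dot u w.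
Proof. by rewrite dotC dotDl !(dotC _ u). Qed.

Lemma dotZr c u v : dot u (c *: v) = c * dot u v.
Proof. by rewrite dotC dotZl dotC. Qed.

Lemma dotBr u v w : dot u (v - w) = dot u v - dot u w.
Proof. by rewrite dotC dotBl !(dotC _ u). Qed.

Lemma dot0l u : dot 0 u = 0.
Proof. by rewrite -(scale0r 0) dotZl mul0r. Qed.

Lemma dotuu_ge0 u : 0 <= dot u u.
Proof. by rewrite dotE sumr_ge0 // => i _; rewrite -expr2 sqr_ge0. Qed.

Lemma dotuu_eq0 u : dot u u = 0 -> u = 0.
Proof.
rewrite dotE => /eqP; rewrite psumr_eq0; last first.
  by move=> i _; rewrite -expr2 sqr_ge0.
move=> /allP u0; apply/colP => i; rewrite mxE.
by have := u0 i (mem_index_enum i); rewrite /= mulf_eq0 orbb => /eqP.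
Qed.

Lemma l2norm_sqr u : l2norm u ^+ 2 = dot u u.
Proof.
by rewrite /l2norm sqr_sqrtr ?sumr_ge0 // => [|i _]; rewrite ?sqr_ge0 // dotE.
Qed.

Lemma quad_formE A u : quad_form A u = dot u (A *m u).
Proof. by rewrite /quad_form /dot mulmxA. Qed.

Lemma quad_formB A B u : quad_form (A - B) u = quad_form A u - quad_form B u.
Proof. by rewrite !quad_formE mulmxBl dotBr. Qed.

(** Cauchy-Schwarz, read off from the squared length of [dot v v *: u - dot u v *: v]. *)
Lemma dot_sqr_le u v : dot u v ^+ 2 <= dot u u * dot v v.
Proof.
have [v0|v0] := eqVneq (dot v v) 0.
  by rewrite (dotuu_eq0 v0) dotC !dot0l mulr0 expr0n.
have vp : 0 < dot v v by rewrite lt_def v0 dotuu_ge0.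
have := dotuu_ge0 (dot v v *: u - dot u v *: v).
have -> : dot (dot v v *: u - dot u v *: v) (dot v v *: u - dot u v *: v) =
    dot v v * (dot u u * dot v v - dot u v ^+ 2).
  by rewrite !(dotBl, dotBr, dotZl, dotZr) (dotC v u); ring.
by rewrite pmulr_rge0 // subr_ge0.
Qed.

Lemma dot_sqr_le1 u v : dot u u <= 1 -> dot v v <= 1 -> dot u v ^+ 2 <= 1.
Proof.
move=> u1 v1; apply: le_trans (dot_sqr_le u v) _.
by rewrite -(mulr1 1) ler_pM ?dotuu_ge0.
Qed.

Lemma dot_norm_le1 u v : dot u u <= 1 -> dot v v <= 1 -> `|dot u v| <= 1.
Proof.
move=> u1 v1; have := dot_sqr_le1 u1 v1.
by rewrite -[_ ^+ 2]ger0_norm ?sqr_ge0 // normrX expr_le1.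
Qed.

Lemma dotuu_add_le u v :
  dot (u + v) (u + v) <= 2 * dot u u + 2 * dot v v.
Proof.
have := dotuu_ge0 (u - v).
rewrite !(dotBl, dotBr, dotDl, dotDr) (dotC v u) => H; lra.
Qed.

Lemma dot_sub_le u v : dot u u <= 1 -> dot v v <= 1 ->
  dot (u - v) (u - v) <= 2 - 2 * dot u v.
Proof. by rewrite !(dotBl, dotBr) (dotC v u) => *; lra. Qed.

Lemma l1norm_ge0 u : 0 <= l1norm u.
Proof. exact: sumr_ge0. Qed.

Lemma l1normB u v : l1norm (u - v) <= l1norm u + l1norm v.
Proof.
by rewrite /l1norm -big_split; apply: ler_sum => i _; rewrite !mxE ler_normB.
Qed.

Lemma l1normZ c u : l1norm (c *: u) = `|c| * l1norm u.
Proof. by rewrite /l1norm mulr_sumr; apply: eq_bigr => i _; rewrite mxE normrM. Qed.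

Lemma ler_mx_norm_entry A i j : `|A i j| <= mx_norm A.
Proof. by rewrite mx_normrE; apply: (le_bigmax _ _ (i, j)). Qed.

(** Hoelder's inequality: this is how an entrywise error eps becomes eps * tau^2 on vectors of
    l1-norm at most tau. *)
Lemma quad_form_norm_le A u : `|quad_form A u| <= mx_norm A * l1norm u ^+ 2.
Proof.
have -> : quad_form A u = \sum_i \sum_j u i 0 * A i j * u j 0.
  rewrite quad_formE dotE; apply: eq_bigr => i _; rewrite mxE mulr_sumr.
  by apply: eq_bigr => j _; rewrite mulrA.
have -> : mx_norm A * l1norm u ^+ 2 =
    \sum_i \sum_j `|u i 0| * mx_norm A * `|u j 0|.
  rewrite expr2 mulrCA mulr_suml; apply: eq_bigr => i _.
  by rewrite mulrA mulr_sumr.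
apply: le_trans (ler_norm_sum _ _ _) _; apply: ler_sum => i _.
apply: le_trans (ler_norm_sum _ _ _) _; apply: ler_sum => j _.
by rewrite !normrM ler_wpM2r // ler_wpM2l // ler_mx_norm_entry.
Qed.

End Dot.

(** * The deflation maps I - a a^T and their products *)

Definition proj (R : realType) (p : nat) (a u : 'cV[R]_p) : 'cV[R]_p :=
  u - dot a u *: a.

Section Projections.
Variables (R : realType) (p : nat).
Implicit Types (a b u v : 'cV[R]_p).

Lemma projE a u : (1%:M - a *m a^T) *m u = proj a u.
Proof.
rewrite mulmxBl mul1mx -mulmxA; congr (_ - _).
by apply/colP => i; rewrite !mxE big_ord1 mulrC /dot.
Qed.

Lemma dot_projl a u v : dot (proj a u) v = dot u v - dot a u * dot a v.
Proof. by rewrite dotBl dotZl. Qed.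

Lemma dot_proj_adj a u v : dot (proj a u) v = dot u (proj a v).
Proof. by rewrite (dotC u) !dot_projl (dotC v) mulrC. Qed.

Lemma dotuu_proj a u :
  dot (proj a u) (proj a u) = dot u u - (2 - dot a a) * dot a u ^+ 2.
Proof.
by rewrite dot_projl !dotBr !dotZr (dotC u a); ring.
Qed.

Lemma projB a u v : proj a (u - v) = proj a u - proj a v.
Proof. by rewrite -!projE mulmxBr. Qed.

(** When [a] is not a unit vector, [proj a] need not be idempotent, but the factor 2 - |a|^2 stays
    nonnegative, so the map is still a contraction. *)
Lemma dotuu_proj_le a u : dot a a <= 1 ->
  dot (proj a u) (proj a u) <= dot u u.
Proof.
move=> a1; rewrite dotuu_proj gerBl mulr_ge0 ?sqr_ge0 //; lra.
Qed.

(** With P_j = I - a_j a_j^T, [proj_seq a k] is P_0 ... P_(k-1), whose last factor acts first, and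
    [proj_rev a k] is its transpose. For [a] the PMD vectors, these are Q_(k+1) and its transpose in
    the 1-based numbering of the overview. *)
Fixpoint proj_seq (a : nat -> 'cV[R]_p) (k : nat) (u : 'cV[R]_p) : 'cV[R]_p :=
  if k is j.+1 then proj_seq a j (proj (a j) u) else u.

Fixpoint proj_rev (a : nat -> 'cV[R]_p) (k : nat) (u : 'cV[R]_p) : 'cV[R]_p :=
  if k is j.+1 then proj (a j) (proj_rev a j u) else u.

Lemma dot_proj_seq_adj (a : nat -> 'cV[R]_p) k u v :
  dot (proj_seq a k u) v = dot u (proj_rev a k v).
Proof. by elim: k u => //= k IH u; rewrite IH dot_proj_adj. Qed.

Lemma quad_form_deflated A (a : nat -> 'cV[R]_p) k u :
  quad_form (deflated A a k) u = quad_form A (proj_seq a k u).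
Proof.
elim: k u => //= k IH u; rewrite -IH /deflate !quad_formE -!mulmxA !projE.
by rewrite dot_proj_adj.
Qed.

Section Contractions.
Variables (a : nat -> 'cV[R]_p) (k : nat).
Hypothesis a_le1 : forall j, (j < k)%N -> dot (a j) (a j) <= 1.

Lemma dotuu_proj_seq_le u :
  dot (proj_seq a k u) (proj_seq a k u) <= dot u u.
Proof.
elim: k a_le1 u => //= m IH H u.
apply: le_trans (IH _ _) _ => [j jm|]; first by apply: H; rewrite ltnS ltnW.
exact/dotuu_proj_le/H.
Qed.

(** Each factor subtracts <a_j, u'> a_j for the current vector u'. Both vectors lie in the unit
    ball, so the coefficient is at most 1 in absolute value and the l1-norm grows by at most tau. *)
Lemma l1norm_proj_seq_le tau u : dot u u <= 1 ->
  (forall j, (j < k)%N -> l1norm (a j) <= tau) ->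
  l1norm (proj_seq a k u) <= l1norm u + k%:R * tau.
Proof.
elim: k a_le1 u => /= [|m IH] H u u1 Ht; first by rewrite mul0r addr0.
have H' j : (j < m)%N -> dot (a j) (a j) <= 1 by move=> jm; apply/H/ltnW.
apply: le_trans (IH H' _ _ _) _.
- exact: le_trans (dotuu_proj_le _ (H _ (ltnSn m))) u1.
- by move=> j jm; apply/Ht/ltnW.
have /= := l1normB u (dot (a m) u *: a m); rewrite l1normZ => H1.
have H2 : `|dot (a m) u| * l1norm (a m) <= tau.
  apply: le_trans (Ht _ (ltnSn m)).
  by rewrite ler_piMl ?l1norm_ge0 // dot_norm_le1 // H.
rewrite -natr1 mulrDl mul1r /proj; lra.
Qed.

Lemma dotuu_proj_rev_le u :
  dot (proj_rev a k u) (proj_rev a k u) <= dot u u.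
Proof.
elim: k a_le1 => //= m IH H; apply: le_trans (dotuu_proj_le _ (H _ _)) _ => //.
by apply: IH => j jm; apply/H/ltnW.
Qed.

End Contractions.

(** * Deflation by vectors close, up to sign, to an orthonormal family *)

Section NearOrthonormal.
Variables (a u : nat -> 'cV[R]_p) (k : nat) (c : R).
Hypothesis a_le1 : forall j, (j < k)%N -> dot (a j) (a j) <= 1.
Hypothesis u_orthonormal :
  forall i j, (i <= k)%N -> (j <= k)%N -> dot (u i) (u j) = (i == j)%:R.
Hypothesis c_ge0 : 0 <= c.
Hypothesis a_near_u : forall j, (j < k)%N -> 1 - c <= dot (a j) (u j) ^+ 2.

Lemma u_unit j : (j <= k)%N -> dot (u j) (u j) = 1.
Proof. by move=> jk; rewrite (u_orthonormal jk jk) eqxx. Qed.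

(* Bessel's inequality for the orthonormal pair (u i, u j). *)
Lemma dot_near_orth i j : (i < k)%N -> (j <= k)%N -> i != j ->
  dot (a i) (u j) ^+ 2 <= c.
Proof.
move=> ik jk ij.
have uii := u_unit (ltnW ik); have ujj := u_unit jk.
have uij : dot (u i) (u j) = 0.
  by rewrite (u_orthonormal (ltnW ik) jk) (negPf ij).
have uji : dot (u j) (u i) = 0 by rewrite dotC.
have := dotuu_ge0 (a i - dot (a i) (u i) *: u i - dot (a i) (u j) *: u j).
rewrite !(dotBl, dotBr, dotZl, dotZr) uii ujj uij uji.
rewrite !(dotC (u _) (a i)) => H.
have := a_near_u ik; have := a_le1 ik; move: H; rewrite !expr2 => *; lra.
Qed.

(** Let b be the current image of u_j and D = 1 - <b, u_j>. The next factor costs s t with s = <a_i,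
    b> and t = <a_i, u_j>, where t^2 <= c and (s - t)^2 <= |b - u_j|^2 <= 2 D. Hence s t <= 2 D +
    (3/2) c, so D at most triples up to a multiple of c, which gives the powers of 3. *)
Lemma dot_proj_rev_near i j : (i <= j)%N -> (j <= k)%N ->
  1 - (3 ^+ i - 1) * c <= dot (proj_rev a i (u j)) (u j).
Proof.
move=> + jk; have ujj := u_unit jk.
have uj1 : dot (u j) (u j) <= 1 by rewrite ujj.
elim: i => [|i IH] ij; first by rewrite /= ujj subrr mul0r subr0.
have ik : (i < k)%N by apply: leq_trans ij jk.
have {IH} := IH (ltnW ij); rewrite /= dot_projl exprS.
set b := proj_rev a i (u j) => IH.
have b1 : dot b b <= 1.
  rewrite -ujj; apply: dotuu_proj_rev_le => m mi.
  by apply: a_le1; apply: ltn_trans ik.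
have bu := dot_sub_le b1 uj1.
have au := dot_near_orth ik jk (negbT (ltn_eqF ij)).
have abu : dot (a i) (b - u j) ^+ 2 <= dot (b - u j) (b - u j).
  apply: le_trans (dot_sqr_le _ _) _.
  by rewrite ler_piMl ?dotuu_ge0 ?a_le1.
move: abu; rewrite dotBr; set s := dot (a i) b; set t := dot (a i) (u j) in au *.
move=> abu.
(* Twice the difference of the two sides is (2 s - 3 t)^2 + t^2. *)
have st : 2 * (s * t) <= 2 * (s - t) ^+ 2 + 3 * t ^+ 2.
  have := sqr_ge0 (2 * s - 3 * t); have := sqr_ge0 t; rewrite !expr2 => *; lra.
rewrite !expr2 in abu st au.
have stc : s * t <= 2 - 2 * dot b (u j) + 3 / 2 * c by lra.
move: IH; move: (_ ^+ i) => x IH.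
by have c0 := c_ge0; lra.
Qed.

(** The factors before P_j move u_j only slightly, P_j nearly annihilates u_j, and the later factors
    are contractions. *)
Lemma dotuu_proj_rev_small j : (j < k)%N ->
  dot (proj_rev a k (u j)) (proj_rev a k (u j)) <= 4 * 3 ^+ k * c.
Proof.
move=> jk; have ujj := u_unit (ltnW jk).
have uj1 : dot (u j) (u j) <= 1 by rewrite ujj.
have a1 m i : (m <= k)%N -> (i < m)%N -> dot (a i) (a i) <= 1.
  by move=> mk im; apply: a_le1; apply: leq_trans mk.
have le3 : 3 ^+ j * c <= 3 ^+ k * c.
  by rewrite ler_wpM2r // ler_weXn2l ?ler1n // ltnW.
(* The number m of factors varies while the bound keeps the fixed [k]; the base case is m = j + 1,
   where P_j acts last. *)
suff H m : (j < m)%N -> (m <= k)%N ->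
    dot (proj_rev a m (u j)) (proj_rev a m (u j)) <= 4 * 3 ^+ k * c.
  exact: H.
elim: m => // m IH; rewrite ltnS leq_eqVlt => /orP[/eqP jm|jm] mk; last first.
  apply: le_trans (IH jm (ltnW mk)).
  exact/dotuu_proj_le/a_le1.
subst m; rewrite /=; set b := proj_rev a j (u j).
have bu : dot b (u j) >= 1 - (3 ^+ j - 1) * c.
  by apply: dot_proj_rev_near => //; apply: ltnW.
have b1 : dot b b <= 1.
  by rewrite -ujj; apply: dotuu_proj_rev_le => i; apply/a1/ltnW.
have bu2 := dot_sub_le b1 uj1.
have -> : proj (a j) b = proj (a j) (b - u j) + proj (a j) (u j).
  by rewrite projB subrK.
apply: le_trans (dotuu_add_le _ _) _.
have p1 := dotuu_proj_le (b - u j) (a_le1 jk).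
have p2 : dot (proj (a j) (u j)) (proj (a j) (u j)) <= c.
  rewrite dotuu_proj ujj.
  have := a_near_u jk; have := a_le1 jk.
  move=> aj1 aju.
  have : 0 <= (1 - dot (a j) (a j)) * dot (a j) (u j) ^+ 2.
    by rewrite mulr_ge0 ?sqr_ge0 // subr_ge0.
  lra.
by have c0 := c_ge0; lra.
Qed.

End NearOrthonormal.
End Projections.

(** After a change of sign of [a], <a, b> >= <a, b>^2 gives |a - b|^2 <= 2 g, and likewise |b - u|^2
    <= 2 h, so |a - u|^2 <= 4 g + 4 h. Expanding this square with |a|^2 >= <a, b>^2 >= 1 - g adds
    one more g, hence 5 g + 4 h. *)
Lemma dot_near_trans (R : realType) (p : nat) (a b u : 'cV[R]_p) (g h : R) :
  dot a a <= 1 -> dot b b <= 1 -> dot u u = 1 ->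
  1 - g <= dot a b ^+ 2 -> 1 - h <= dot b u ->
  1 - (5 * g + 4 * h) <= dot a u ^+ 2.
Proof.
wlog ab0 : a / 0 <= dot a b => [hw|] a1 b1 u1 ab bu.
  have [/hw|ab0] := leP 0 (dot a b); first exact.
  have aN w : dot (- a) w = - dot a w by rewrite -scaleN1r dotZl mulN1r.
  rewrite -[leRHS]sqrrN -aN; apply: hw => //; rewrite ?aN ?sqrrN //.
    by rewrite oppr_ge0 ltW.
  by rewrite dotC aN opprK.
have ab1 : dot a b ^+ 2 <= dot a b.
  rewrite expr2 ler_piMl //; apply: le_trans (ler_norm _) _.
  exact: dot_norm_le1.
have aa : dot a b ^+ 2 <= dot a a.
  by apply: le_trans (dot_sqr_le a b) _; rewrite ler_piMr ?dotuu_ge0.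
have := dotuu_add_le (a - b) (b - u).
have := dot_sub_le a1 b1; have u1' : dot u u <= 1 by rewrite u1.
have := dot_sub_le b1 u1'.
have -> : a - b + (b - u) = a - u by rewrite addrA subrK.
rewrite [dot (a - u) _]dotBl !dotBr u1 (dotC u a) => bu2 ab2 au2.
have au : 1 - (5 / 2 * g + 2 * h) <= dot a u by lra.
have := sqr_ge0 (dot a u - 1); rewrite !expr2 => *; lra.
Qed.

(** * Eigenvector expansion and spectral bounds on quadratic forms *)

Section Eigensystem.
Variables (R : realType) (p : nat) (M : 'M[R]_p).
Variables (lambda : 'I_p -> R) (v : 'I_p -> 'cV[R]_p).
Hypothesis Mv : ordered_eigensystem M lambda v.

Lemma eigen_dot i j : dot (v i) (v j) = (i == j)%:R.
Proof. exact: eigen_orthonormal Mv i j. Qed.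

(** Completeness: orthonormality says V^T V = I, and for a square matrix this implies V V^T = I. *)
Lemma eigen_expand w : w = \sum_i dot (v i) w *: v i.
Proof.
pose V : 'M[R]_p := \matrix_(i, j) v j i 0.
have VV : V *m V^T = 1%:M.
  apply: mulmx1C; apply/matrixP => i j; rewrite !mxE -eigen_dot dotE.
  by apply: eq_bigr => l _; rewrite !mxE.
apply/colP => r; rewrite -[in LHS](mul1mx w) -VV -mulmxA mxE summxE.
apply: eq_bigr => i _; rewrite !mxE mulrC dotE; congr (_ * _).
by apply: eq_bigr => l _; rewrite !mxE.
Qed.

Lemma dot_sumr (u : 'cV[R]_p) (f : 'I_p -> 'cV[R]_p) :
  dot u (\sum_i f i) = \sum_i dot u (f i).
Proof. by rewrite /dot mulmx_sumr summxE. Qed.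

Lemma dotuu_eigen w : dot w w = \sum_i dot (v i) w ^+ 2.
Proof.
rewrite {2}(eigen_expand w) dot_sumr; apply: eq_bigr => i _.
by rewrite dotZr (dotC w).
Qed.

Lemma quad_form_eigen w : quad_form M w = \sum_i lambda i * dot (v i) w ^+ 2.
Proof.
rewrite quad_formE {2}(eigen_expand w) mulmx_sumr dot_sumr.
apply: eq_bigr => i _; rewrite -scalemxAr (eigen_eq Mv) !dotZr (dotC w); ring.
Qed.

Lemma sym_posdef_eigen_gt0 i : sym_posdef M -> 0 < lambda i.
Proof.
case=> _ /(_ (v i)); rewrite quad_formE (eigen_eq Mv) dotZr eigen_dot eqxx mulr1.
apply; apply/eqP => vi0; have := eigen_dot i i.
by rewrite vi0 dot0l eqxx => /eqP; rewrite eq_sym oner_eq0.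
Qed.

Hypothesis lambda_ge0 : forall i, 0 <= lambda i.

Lemma eigen_quad_form_ge i w : lambda i * dot (v i) w ^+ 2 <= quad_form M w.
Proof.
rewrite quad_form_eigen (bigD1 i) //= lerDl sumr_ge0 // => j _.
by rewrite mulr_ge0 ?sqr_ge0.
Qed.

(** Each of the [i0] earlier terms is at most [x]; the later eigenvalues are at most [lambda i1],
    and by Parseval the weight away from [v i0] is at most 1 - <v i0, w>^2. *)
Lemma eigen_quad_form_le (i0 i1 : 'I_p) (x : R) w :
    i1 = i0.+1 :> nat -> dot w w <= 1 ->
    (forall i : 'I_p, (i < i0)%N -> lambda i * dot (v i) w ^+ 2 <= x) ->
  quad_form M w <= i0%:R * x + lambda i0 * dot (v i0) w ^+ 2
                   + lambda i1 * (1 - dot (v i0) w ^+ 2).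
Proof.
move=> i10 w1 x_bound; rewrite quad_form_eigen (bigD1 i0) //=.
have wsum : \sum_(i | i != i0) dot (v i) w ^+ 2 <= 1 - dot (v i0) w ^+ 2.
  by have := w1; rewrite (dotuu_eigen w) (bigD1 i0) //= -lerBrDl.
have -> : i0%:R * x = \sum_(i < p | i != i0) if (i < i0)%N then x else 0.
  rewrite -big_mkcondr (eq_bigl (fun i : 'I_p => (i < i0)%N)) => [|i]; last first.
    by rewrite -val_eqE /= ltn_neqAle andbA andbb.
  by rewrite (big_ord_narrow (ltnW (ltn_ord i0))) sumr_const card_ord mulr_natl.
rewrite [X in _ <= X + _]addrC -addrA lerD2l.
apply: le_trans (lerD (lexx _) (ler_wpM2l (lambda_ge0 i1) wsum)).
rewrite mulr_sumr -big_split /=; apply: ler_sum => i ii0; case: ltnP => ii.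
  by rewrite -[leLHS]addr0 lerD ?x_bound // mulr_ge0 ?sqr_ge0.
rewrite add0r ler_wpM2r ?sqr_ge0 // (eigen_ordered Mv) // i10.
by rewrite ltn_neqAle ii andbT eq_sym.
Qed.

End Eigensystem.

(** * The error constant and the passage from one index to the next *)

(** Turns a constant [c] valid for the earlier indices into one for the next. It has the form 5 g +
    4 h of [dot_near_trans]. The three terms over [Delta] come from replacing Mhat by M twice, from
    the earlier eigendirections, and from the loss in the lower bound on the maximum. *)
Definition pmd_const (R : realType) (d : nat) (Delta ell c : R) : R :=
  5 * ((2 * d.+1%:R ^+ 2 + d%:R * (ell * (4 * 3 ^+ d * c))
        + 2 * (3 ^+ d * c) * ell) / Delta) + 4 * (3 ^+ d * c).

(** Lets one constant serve the new index and all earlier ones. *)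
Lemma pmd_const_ge (R : realType) (d : nat) (Delta ell c : R) :
  0 < Delta -> 0 <= ell -> 0 <= c -> c <= pmd_const d Delta ell c.
Proof.
move=> D0 ell0 c0; rewrite /pmd_const.
have le1 : c <= 3 ^+ d * c by rewrite ler_peMl // exprn_ege1 // ler1n.
have g0 : 0 <= (2 * d.+1%:R ^+ 2 + d%:R * (ell * (4 * 3 ^+ d * c))
    + 2 * (3 ^+ d * c) * ell) / Delta.
  rewrite divr_ge0 ?(ltW D0) // !addr_ge0 ?mulr_ge0 ?exprn_ge0 ?ler0n //.
lra.
Qed.

Section Step.
Variables (R : realType) (d p : nat) (M Mhat : 'M[R]_p).
Variables (lambda : 'I_p -> R) (v : 'I_p -> 'cV[R]_p) (vhat : nat -> 'cV[R]_p).
Variables (tau eps : R).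
Hypothesis Mv : ordered_eigensystem M lambda v.
Hypothesis vhatP : pmd_vectors d tau Mhat vhat.
Hypothesis Meps : mx_norm (Mhat - M) <= eps.

Lemma pmd_vector_le1 j : (j < d)%N -> dot (vhat j) (vhat j) <= 1.
Proof. by case/vhatP => -[_]; rewrite l2norm_sqr. Qed.

(** The deflation product sends [w] to a vector of l1-norm at most (k + 1) tau, whence the factor (d
    + 1)^2. *)
Lemma quad_form_proj_seq_near k w : (k < d)%N -> pmd_feasible tau w ->
  `|quad_form (deflated Mhat vhat k) w - quad_form M (proj_seq vhat k w)|
    <= d.+1%:R ^+ 2 * (eps * tau ^+ 2).
Proof.
move=> kd [wtau]; rewrite l2norm_sqr => w1.
rewrite quad_form_deflated -quad_formB.
apply: le_trans (quad_form_norm_le _ _) _.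
have tau0 : 0 <= tau by apply: le_trans wtau; apply: l1norm_ge0.
have -> : d.+1%:R ^+ 2 * (eps * tau ^+ 2) = eps * (d.+1%:R * tau) ^+ 2.
  by rewrite exprMn mulrCA.
apply: ler_pM => //; first by rewrite mx_normrE bigmax_ge_id.
  by rewrite exprn_ge0 ?l1norm_ge0.
rewrite ler_pXn2r ?nnegrE ?l1norm_ge0 ?mulr_ge0 //.
apply: le_trans (l1norm_proj_seq_le _ w1 (tau := tau) _) _.
- by move=> j jk; apply/pmd_vector_le1/(ltn_trans jk).
- by move=> j jk; case: (vhatP (ltn_trans jk kd)) => -[].
rewrite -natr1 mulrDl mul1r addrC lerD // ler_wpM2r // ler_nat ltnW //.
Qed.

Variables (Delta ell c : R) (i0 i1 : 'I_p).
Hypothesis lambda_ge0 : forall i, 0 <= lambda i.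
Hypothesis lambda_le : forall i, lambda i <= ell.
Hypothesis Delta_gt0 : 0 < Delta.
Hypothesis Delta_gap : Delta <= lambda i0 - lambda i1.
Hypothesis i1E : i1 = i0.+1 :> nat.
Hypothesis i0d : (i0 < d)%N.
Hypothesis c_ge0 : 0 <= c.
Hypothesis v_tau : l1norm (v i0) <= tau.
Let e := eps * tau ^+ 2.

(** Optimality of [vhat i0] against the feasible [v i0] links a lower bound near [lambda i0] to the
    spectral upper bound at [w]; the difference of the two controls Delta * (1 - <v i0, w>^2). *)
Lemma pmd_step :
  (forall i : 'I_p, (i < i0)%N -> 1 - c * e <= dot (vhat i) (v i) ^+ 2) ->
  1 - pmd_const d Delta ell c * e <= dot (vhat i0) (v i0) ^+ 2.
Proof.
(* Eigenvectors reindexed by naturals; the default [i0] is taken only for j >= p, while only j <= i0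
   occurs below. *)
move=> near_v; pose u j := v (insubd i0 j).
have uE (i : 'I_p) : u i = v i by rewrite /u valKd.
have eps0 : 0 <= eps by apply: le_trans Meps; rewrite mx_normrE bigmax_ge_id.
have e0 : 0 <= e by rewrite mulr_ge0 ?sqr_ge0.
have ce0 : 0 <= c * e by rewrite mulr_ge0.
have ell0 : 0 <= ell := le_trans (lambda_ge0 i0) (lambda_le i0).
have lt_p j : (j <= i0)%N -> (j < p)%N.
  by move=> ji0; apply: leq_ltn_trans (ltn_ord i0).
have u_orth i j : (i <= i0)%N -> (j <= i0)%N -> dot (u i) (u j) = (i == j)%:R.
  move=> ik jk; rewrite -[i]/(val (Ordinal (lt_p _ ik))).
  by rewrite -[j]/(val (Ordinal (lt_p _ jk))) !uE (eigen_dot Mv).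
have a_le1 j : (j < i0)%N -> dot (vhat j) (vhat j) <= 1.
  by move=> jk; apply/pmd_vector_le1/(ltn_trans jk).
have a_near j : (j < i0)%N -> 1 - c * e <= dot (vhat j) (u j) ^+ 2.
  move=> jk; rewrite -[j]/(val (Ordinal (lt_p _ (ltnW jk)))) uE.
  exact: near_v.
have u1 : dot (v i0) (v i0) = 1 by rewrite (eigen_dot Mv) eqxx.
set b := proj_rev vhat i0 (v i0); set w := proj_seq vhat i0 (vhat i0).
have le3 : 3 ^+ i0 * (c * e) <= 3 ^+ d * c * e.
  by rewrite -mulrA ler_wpM2r // ler_weXn2l ?ler1n // ltnW.
have bv : 1 - 3 ^+ d * c * e <= dot b (v i0).
  have := dot_proj_rev_near a_le1 u_orth ce0 a_near (leqnn i0) (leqnn i0).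
  by rewrite uE -/b; apply: le_trans; lra.
have b1 : dot b b <= 1 by rewrite -u1; apply: dotuu_proj_rev_le.
have vhat1 := pmd_vector_le1 i0d.
have w1 : dot w w <= 1.
  by apply: le_trans vhat1; apply: dotuu_proj_seq_le.
have wE i : dot (v i) w = dot (vhat i0) (proj_rev vhat i0 (v i)).
  by rewrite dotC dot_proj_seq_adj.
have wsmall (i : 'I_p) : (i < i0)%N ->
    lambda i * dot (v i) w ^+ 2 <= ell * (4 * 3 ^+ d * c * e).
  move=> ii0; apply: ler_pM => //; rewrite ?sqr_ge0 // wE.
  apply: le_trans (dot_sqr_le _ _) _.
  apply: le_trans (ler_piMl (dotuu_ge0 _) vhat1) _.
  rewrite -uE.
  apply: le_trans (dotuu_proj_rev_small a_le1 u_orth ce0 a_near ii0) _.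
  lra.
have feas_v : pmd_feasible tau (v i0) by split; rewrite // l2norm_sqr u1.
have [feas_vhat /(_ _ feas_v) vhat_max] := vhatP i0d.
have := quad_form_proj_seq_near i0d feas_v.
have := quad_form_proj_seq_near i0d feas_vhat.
rewrite -/e -/w => /ler_normlP[_ near_w] /ler_normlP[near_b _].
have up := eigen_quad_form_le Mv lambda_ge0 i1E w1 wsmall.
have lo := eigen_quad_form_ge Mv lambda_ge0 i0 (proj_seq vhat i0 (v i0)).
have bE : dot (v i0) (proj_seq vhat i0 (v i0)) = dot b (v i0).
  by rewrite dotC dot_proj_seq_adj dotC.
(* From x^2 >= 2 x - 1, valid whatever the sign of the lower bound on x. *)
have bv2 : 1 - 2 * (3 ^+ d * c * e) <= dot b (v i0) ^+ 2.
  have := sqr_ge0 (dot b (v i0) - 1); move: bv; rewrite !expr2 => *; lra.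
rewrite bE in lo.
have {}lo := le_trans (ler_wpM2l (lambda_ge0 i0) bv2) lo.
have y1 : dot (v i0) w ^+ 2 <= 1 by apply: dot_sqr_le1 => //; rewrite u1.
have := ler_wpM2r (_ : 0 <= 1 - dot (v i0) w ^+ 2) Delta_gap.
rewrite subr_ge0 => /(_ y1) gap_y.
have t0 : 0 <= 3 ^+ d * c * e.
  by rewrite -mulrA mulr_ge0 ?exprn_ge0 ?ler0n.
have i0x : i0%:R * (ell * (4 * 3 ^+ d * c * e)) <=
    d%:R * (ell * (4 * 3 ^+ d * c * e)).
  by rewrite ler_wpM2r ?ler_nat ?(ltnW i0d) // mulr_ge0 //; lra.
have lx : 2 * (3 ^+ d * c * e) * lambda i0 <= 2 * (3 ^+ d * c * e) * ell.
  by rewrite ler_wpM2l //; lra.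
set num := 2 * d.+1%:R ^+ 2 + d%:R * (ell * (4 * 3 ^+ d * c))
  + 2 * (3 ^+ d * c) * ell.
have gap_num : Delta * (1 - dot (v i0) w ^+ 2) <= num * e.
  rewrite /num; move: (dot (v i0) w ^+ 2) up lo y1 gap_y => y up lo y1 gap_y.
  lra.
(* By adjointness <v i0, w> = <vhat i0, b>, so the gap estimate says that [vhat i0] is close to [b]
   up to sign. *)
have yb : 1 - num / Delta * e <= dot (vhat i0) b ^+ 2.
  rewrite -wE lerBlDr addrC -lerBlDr mulrAC ler_pdivlMr // mulrC.
  exact: gap_num.
have := dot_near_trans vhat1 b1 u1 yb bv.
rewrite /pmd_const -/num; apply: le_trans; lra.
Qed.

End Step.

(** * Induction over the indices and passage to angles *)

(** The iteration starts from 0 because the first index has no predecessors; after m rounds one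
    constant covers all indices below m. *)
Lemma pmd_near (R : realType) (d p : nat) (M Mhat : 'M[R]_p)
    (lambda : 'I_p -> R) (v : 'I_p -> 'cV[R]_p) (vhat : nat -> 'cV[R]_p)
    (tau eps Delta ell : R) :
  ordered_eigensystem M lambda v -> pmd_vectors d tau Mhat vhat ->
  mx_norm (Mhat - M) <= eps ->
  (forall i, 0 <= lambda i) -> (forall i, lambda i <= ell) -> 0 < Delta ->
  (forall i : 'I_p, (i < d)%N -> l1norm (v i) <= tau /\
     exists2 i1 : 'I_p, i1 = i.+1 :> nat & Delta <= lambda i - lambda i1) ->
  forall (m : nat) (i : 'I_p), (m <= d)%N -> (i < m)%N ->
    1 - iter m (pmd_const d Delta ell) 0 * (eps * tau ^+ 2)
      <= dot (vhat i) (v i) ^+ 2.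
Proof.
move=> Mv vhatP Meps lambda_ge0 lambda_le D0 gapP m i0 md im.
have ell0 : 0 <= ell := le_trans (lambda_ge0 i0) (lambda_le i0).
have e0 : 0 <= eps * tau ^+ 2.
  rewrite mulr_ge0 ?sqr_ge0 //; apply: le_trans Meps.
  by rewrite mx_normrE bigmax_ge_id.
have F0 j : 0 <= iter j (pmd_const d Delta ell) 0.
  elim: j => //= j IH; apply: le_trans (pmd_const_ge _ D0 ell0 IH); exact: IH.
(* The new index i = m uses [pmd_step]; the older ones keep their bound with a larger constant. *)
elim: m i0 md im => // m IH i md; rewrite ltnS leq_eqVlt => /orP[/eqP im|im].
  have [vtau [i1 i1E gap_i]] := gapP i (leq_trans (eq_leq (congr1 succn im)) md).
  rewrite iterS; apply: (pmd_step Mv vhatP Meps) i1E _ _ _ _ => //.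
    by rewrite im.
  by move=> j; rewrite im => jm; apply: IH => //; apply: ltnW.
apply: le_trans (IH i (ltnW md) im); rewrite lerD2l lerN2 ler_wpM2r //.
exact: pmd_const_ge.
Qed.

(** Since |w| <= 1, dividing by |w|^2 can only increase the squared cosine; for w = 0 both sides
    equal 1. *)
Lemma sin2_angle_le (R : realType) (p : nat) (v w : 'cV[R]_p) :
  dot v v = 1 -> dot w w <= 1 -> sin2_angle v w <= 1 - dot w v ^+ 2.
Proof.
move=> v1 w1; rewrite /sin2_angle !l2norm_sqr v1 mul1r -/(dot v w).
case: eqP => [v0|_] /=.
  by move: v1; rewrite v0 dot0l => /eqP; rewrite eq_sym oner_eq0.
case: eqP => [->|/eqP w0]; first by rewrite dot0l expr0n subr0.
have ww : 0 < dot w w.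
  by rewrite lt_def dotuu_ge0 andbT; apply: contra_neq w0; apply: dotuu_eq0.
by rewrite lerD2l lerN2 dotC ler_pdivlMr // ler_piMr ?sqr_ge0.
Qed.

Theorem theorem3 (R : realType) (d : nat) (d_gt0 : (0 < d)%N)
    (Delta : R) (Delta_gt0 : 0 < Delta) (lambda_top : 'I_d -> R) :
  exists c0 : R, 0 < c0 /\
    forall (n p : nat) (dp : (d < p)%N)
      (M : 'M[R]_p) (lambda : 'I_p -> R) (v : 'I_p -> 'cV[R]_p)
      (X : 'M[R]_(n, p)) (Mhat : 'M[R]_p) (vhat : nat -> 'cV[R]_p)
      (tau eps : R),
      sym_posdef M ->
      ordered_eigensystem M lambda v ->
      (forall j : 'I_d, lambda (lead dp j) = lambda_top j) ->
      min_gap d_gt0 dp lambda = Delta ->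
      Mhat = X^T *m X ->
      pmd_vectors d tau Mhat vhat ->
      max_l1norm dp v < tau ->
      mx_norm (Mhat - M) <= eps ->
      forall k : 'I_d,
        sin2_angle (v (lead dp k)) (vhat k) <= c0 * eps * tau ^+ 2.
Proof.
(* A bound on all eigenvalues from the largest one, fixed before n, p and the matrices. *)
pose ell := `|lambda_top (Ordinal d_gt0)|.
pose c0 := iter d (pmd_const d Delta ell) 0.
(* The maximum with 1 makes positivity immediate. *)
exists (Num.max 1 c0); split; first by rewrite lt_max ltr01.
move=> n p dp M lambda v X Mhat vhat tau eps Mpos Mv lambdaE gapE _ vhatP.
move=> v_tau Meps k.
have lambda_ge0 i : 0 <= lambda i by apply/ltW/(sym_posdef_eigen_gt0 Mv).
have lambda_le i : lambda i <= ell.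
  apply: le_trans (ler_norm _); rewrite -lambdaE.
  exact: (eigen_ordered Mv).
have leadP (i : 'I_p) : (i < d)%N -> exists j : 'I_d, i = lead dp j.
  by move=> id; exists (Ordinal id); apply: val_inj.
have vk1 : dot (v (lead dp k)) (v (lead dp k)) = 1.
  by rewrite (eigen_dot Mv) eqxx.
apply: le_trans (sin2_angle_le vk1 (pmd_vector_le1 vhatP (ltn_ord k))) _.
have gapP (i : 'I_p) : (i < d)%N -> l1norm (v i) <= tau /\
    exists2 i1 : 'I_p, i1 = i.+1 :> nat & Delta <= lambda i - lambda i1.
  move=> /leadP[j ->]; split.
    by apply: le_trans (ltW v_tau); apply: (le_bigmax _ _ j).
  by exists (lead_next dp j) => //; rewrite -gapE; apply: bigmin_le.
have near_k : 1 - c0 * (eps * tau ^+ 2) <= dot (vhat k) (v (lead dp k)) ^+ 2.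
  exact: (pmd_near Mv vhatP Meps lambda_ge0 lambda_le Delta_gt0 gapP
    (i := lead dp k) (leqnn d) (ltn_ord k)).
rewrite lerBlDr addrC -lerBlDr; apply: le_trans near_k.
rewrite lerD2l lerN2 -mulrA ler_wpM2r ?le_max ?lexx ?orbT //.
rewrite mulr_ge0 ?sqr_ge0 //; apply: le_trans Meps.
by rewrite mx_normrE bigmax_ge_id.
Qed.
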